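(* Let $G$ be a $5$-regular graph on $n$ vertices that contains no clique on $6$ vertices ($K_6$) as a subgraph. Then $G$ has a path partition with at most $\frac{n}{6+\frac13}=\frac{3n}{19}$ components.
   Context: All graphs are finite, simple and undirected. A path partition of a graph $G=(V,E)$ is a set of vertex-disjoint paths of $G$ (a single vertex is allowed as a path) whose vertex sets together cover $V$; its members are called components. *)

(* Defs.v *)
From mathcomp Require Import all_boot.
Set Implicit Arguments. Unset Strict Implicit. Unset Printing Implicit Defensive.

Definition simple_graph (T : finType) (e : rel T) : Prop :=
  symmetric e /\ irreflexive e.

Definition nbhd (T : finType) (e : rel T) (v : T) : {set T} := [set w | e v w].
Definition regular (T : finType) (e : rel T) (d : nat) : Prop :=
  forall v : T, #|nbhd e v| = d.

Definition is_clique (T : finType) (e : rel T) (S : {set T}) : Prop :=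
  forall x y, x \in S -> y \in S -> x != y -> e x y.
Definition has_clique (T : finType) (e : rel T) (k : nat) : Prop :=
  exists S : {set T}, #|S| = k /\ is_clique e S.

Definition is_graph_path (T : finType) (e : rel T) (p : seq T) : Prop :=
  match p with
  | [::] => False
  | x :: q => path e x q /\ uniq p
  end.

Definition path_partition (T : finType) (e : rel T) (P : seq (seq T)) : Prop :=
  (forall p, p \in P -> is_graph_path e p) /\
  uniq (flatten P) /\
  (forall v : T, v \in flatten P).

(* Main.v *)
(** Take a path partition with the fewest components and, among those, the fewest
    one-vertex components.

    No component is a single vertex: a neighbour [x] of a single vertex [v] must be the
    middle of a component [a x c], and exchanging [v] with [a] gives another optimal
    partition. The set [B] of vertices that become single through such exchanges then has
    more elements than its neighbourhood, which is impossible in a regular graph.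

    Call every vertex of a component spanned by a cycle an end, and the first and last
    vertex of any other component. Every edge from an end to another component carries a
    fee, paid to the component of the end: 2 units in general, but 1 unit if that
    component is spanned by a cycle and has at least 4 vertices. Giving each vertex 3
    units of its own, it suffices that each component has at least 19 units after all fees
    are paid. A component spanned by a cycle pays nothing, and its edges suffice unless it
    is a [K_6]. For a path [a = q_0, ..., q_n = b] not spanned by a cycle, each path edge
    is given a budget of 3, which must cover the fees paid by the path and 2 for each
    non-path edge inside the path at [a] or [b]. Call a vertex receiving if it pays a fee.
    If [a] is adjacent to [q_(i+1)] then [q_i] does not receive, by rotation; if [b] is
    adjacent to [q_i] then [q_(i+1)] does not receive; both do not occur for the same [i].
    Two consecutive vertices can receive only from the same component, which limits what
    they pay. *)

Require Import Defs.
From mathcomp Require Import all_boot.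
From mathcomp Require Import zify.
From Stdlib Require Import Classical.

Set Implicit Arguments. Unset Strict Implicit. Unset Printing Implicit Defensive.

(** * Preliminaries and the arithmetic of the budget *)

Ltac perm_count :=
  apply/permP; let a := fresh "a" in intro a;
  repeat match goal with
  | H : is_true (perm_eq ?s ?t) |- _ => move/permP: H => /(_ a)
  end;
  rewrite -?cats1 /= ?(count_cat, count_rev) /= ?(count_cat, count_rev) /=; clear; lia.

Lemma ex_least (Q : nat -> Prop) n :
  Q n -> exists m, Q m /\ forall k, Q k -> m <= k.
Proof.
elim/ltn_ind: n => n IH Qn.
have [[k [kn Qk]]|no] := classic (exists k, k < n /\ Q k); first exact: IH Qk.
by exists n; split=> // k Qk; case: leqP => // kn; case: no; exists k.
Qed.

(* [R i]: [q_i] receives, and pays [f i]; [A i], [B i]: the path edge [q_i q_(i+1)] is met by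
   the edge [a q_(i+1)], resp. [b q_i]. A path edge gives 3 to its only receiving end, or 2 to
   its right and 1 to its left end if both receive. *)
Lemma budget n (R A B : nat -> bool) (f : nat -> nat) :
  (forall i, i < n -> ~~ (A i && R i)) ->
  (forall i, i < n -> ~~ (B i && R i.+1)) ->
  (forall i, i < n -> ~~ (A i && B i)) ->
  (forall i, ~~ R i -> f i = 0) -> R 0 = false -> R n = false ->
  (forall i, i.+1 < n -> R i.+1 ->
     f i.+1 + 2 * A i + 2 * B i.+1 <= (if R i then 2 else 3) + (if R i.+2 then 1 else 3)) ->
  \sum_(0 <= i < n.+1) f i + 2 * \sum_(0 <= i < n) A i + 2 * \sum_(0 <= i < n) B i <= 3 * n.
Proof.
move=> AR BR AB f0 R0 Rn cost.
(* If [q_(k+1)] receives, its share of edge [k] is held in reserve and the debt [2 * A k] is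
   postponed; both are settled when [f k.+1] is added. *)
have step k : k < n ->
    \sum_(0 <= i < k.+1) f i + 2 * \sum_(0 <= i < k.+1) A i + 2 * \sum_(0 <= i < k.+1) B i
      + R k.+1 * (if R k then 2 else 3) <= 3 * k.+1 + R k.+1 * (2 * A k).
  elim: k => [|k IH] kn.
    rewrite !big_nat1 (f0 0) ?R0 //.
    have := AR 0 kn; have := BR 0 kn; have := AB 0 kn; rewrite R0.
    by case: (A 0); case: (B 0); case: (R 1).
  have {}IH := IH (ltnW kn).
  rewrite ![\sum_(0 <= i < k.+2) _]big_nat_recr //=.
  move: IH; set F := \sum_(0 <= i < k.+1) f i; set SA := \sum_(_ <= _ < _) A _.
  set SB := \sum_(_ <= _ < _) B _.
  have := AR _ kn; have := BR _ kn; have := AB _ kn; have := cost _ kn.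
  have := f0 k.+1.
  move: (F) (SA) (SB) (f k.+1) => {}F {}SA {}SB fk.
  case: (R k.+1) => [_ /(_ isT)|/(_ isT)-> _];
    by case: (R k); case: (R k.+2); case: (A k); case: (A k.+1); case: (B k.+1);
      rewrite //=; clear; lia.
case: n => [|n] in AR BR AB Rn cost step *.
  by rewrite big_nat1 !big_geq // f0 ?R0.
rewrite big_nat_recr //= (f0 n.+1) ?Rn //.
by have := step n (ltnSn n); rewrite Rn; clear; lia.
Qed.

(** * Path partitions and exchanges of components *)

Section PathPartition.

Variables (T : finType) (e : rel T).
Hypotheses (e_sym : symmetric e) (e_irr : irreflexive e).

Implicit Types (p q r s t : seq T) (P Q : seq (seq T)).

Lemma rev_sorted_sym s : sorted e (rev s) = sorted e s.
Proof. by rewrite rev_sorted; apply: eq_sorted => x y; rewrite e_sym. Qed.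

Lemma sorted_link x s y t :
  sorted e (rcons s x ++ y :: t) = [&& sorted e (rcons s x), e x y & sorted e (y :: t)].
Proof. by case: s => [|z s] /=; rewrite ?cat_path ?last_rcons ?cat_rcons //= -?andbA. Qed.

Lemma graph_pathP p :
  is_graph_path e p <-> [/\ p != [::], sorted e p & uniq p].
Proof. by case: p => [|x p] /=; split=> //; [case|case|case=> _ -> ->]. Qed.

Lemma pp_perm P Q : perm_eq P Q -> path_partition e P -> path_partition e Q.
Proof.
move=> PQ [Pp [Pu Pc]]; have PF := perm_flatten PQ; split; [|split].
- by move=> p; rewrite -(perm_mem PQ); apply: Pp.
- by rewrite -(perm_uniq PF).
- by move=> v; rewrite -(perm_mem PF).
Qed.

Lemma pp_exchange ps qs rest :
  path_partition e (ps ++ rest) ->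
  all (fun q => (q != [::]) && sorted e q) qs ->
  perm_eq (flatten qs) (flatten ps) -> path_partition e (qs ++ rest).
Proof.
move=> [Pp [Pu Pc]] qsP qsE.
have PF : perm_eq (flatten (qs ++ rest)) (flatten (ps ++ rest)).
  by rewrite !flatten_cat perm_cat2r.
split; [|split].
- move=> q; rewrite mem_cat => /orP[qin|qin]; last by apply: Pp; rewrite mem_cat qin orbT.
  apply/graph_pathP; have /andP[-> ->] := allP qsP q qin; split=> //.
  move: Pu; rewrite -(perm_uniq PF) flatten_cat cat_uniq => /andP[+ _].
  have /perm_to_rem/perm_flatten/= Eq := qin.
  by rewrite (perm_uniq Eq) cat_uniq => /andP[].
- by rewrite (perm_uniq PF).
- by move=> v; rewrite (perm_mem PF).
Qed.

(** * Minimal partitions *)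

Definition minimal P :=
  path_partition e P /\ forall Q, path_partition e Q -> size P <= size Q.

Lemma min_exchange P ps qs rest :
  minimal P -> perm_eq P (ps ++ rest) ->
  all (fun q => (q != [::]) && sorted e q) qs ->
  perm_eq (flatten qs) (flatten ps) -> size ps <= size qs.
Proof.
move=> [Ppp Pmin] PE qsP qsE.
have := Pmin _ (pp_exchange (pp_perm PE Ppp) qsP qsE).
by rewrite (perm_size PE) !size_cat leq_add2r.
Qed.

Lemma perm_two P p q : p \in P -> q \in P -> p != q ->
  exists rest, perm_eq P ([:: p; q] ++ rest).
Proof.
move=> pP qP pq; exists (rem q (rem p P)).
have qR : q \in rem p P by rewrite rem_mem // eq_sym.
by apply: perm_trans (perm_to_rem pP) _; rewrite /= perm_cons perm_to_rem.
Qed.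

Lemma perm_three P p q r : p \in P -> q \in P -> r \in P ->
  p != q -> p != r -> q != r ->
  exists rest, perm_eq P ([:: p; q; r] ++ rest).
Proof.
move=> pP qP rP pq pr qr.
have [||| rest E] := @perm_two (rem p P) q r; rewrite ?rem_mem // 1?eq_sym //.
exists rest; apply: perm_trans (perm_to_rem pP) _.
by rewrite /= perm_cons.
Qed.

Lemma comp_uniq P p q v : path_partition e P ->
  p \in P -> q \in P -> v \in p -> v \in q -> p = q.
Proof.
move=> [_ [Pu _]] pP qP vp vq; apply/eqP; apply: contraT => pq.
have [rest /perm_flatten E] := perm_two pP qP pq.
move: Pu; rewrite (perm_uniq E) /= cat_uniq => /and3P[_ /hasP[]].
by exists v; rewrite ?mem_cat ?vq.
Qed.

(** Exchanges may reroute a component along any Hamiltonian path of its vertex set. *)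
Definition spans p q := sorted e q && perm_eq q p.

Lemma spans_rev p q : spans p q -> spans p (rev q).
Proof. by rewrite /spans rev_sorted_sym perm_rev. Qed.

(** Joining the two spanning paths along [u v] would save a component. *)
Lemma no_merge P p q u s v t : minimal P -> p \in P -> q \in P -> p != q ->
  spans p (u :: s) -> spans q (v :: t) -> e u v = false.
Proof.
move=> Pmin pP qP pq /spans_rev/andP[ps pE] /andP[qs qE]; apply: negbTE; apply/negP => uv.
have [rest E] := perm_two pP qP pq.
have := min_exchange (qs := [:: rev (u :: s) ++ v :: t]) Pmin E.
rewrite /= rev_cons sorted_link uv qs -rev_cons ps cats0.
rewrite -size_eq0 size_cat addnS /= => /(_ isT).
have : perm_eq (rev (u :: s) ++ v :: t) (p ++ q ++ [::]) by rewrite cats0 perm_cat.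
by move=> -> /(_ isT).
Qed.

(** Otherwise cut [p] between [x] and [y] and join the halves to [q] and [r]: two paths replace
    three. *)
Lemma no_split P p q r x y s1 s2 u t1 v t2 : minimal P ->
  p \in P -> q \in P -> r \in P -> p != q -> p != r -> q != r ->
  spans p (s1 ++ x :: y :: s2) -> spans q (u :: t1) -> spans r (v :: t2) ->
  e x u -> e y v -> False.
Proof.
move=> Pmin pP qP rP pq pr qr.
rewrite -cat_rcons /spans sorted_link => /andP[/and3P[sx xy sy] pE].
move=> /andP[qs qE] /spans_rev/andP[rs rE] xu yv.
have [rest E] := perm_three pP qP rP pq pr qr.
have := min_exchange (qs := [:: rcons s1 x ++ u :: t1; rev (v :: t2) ++ y :: s2]) Pmin E.
rewrite /= rev_cons !sorted_link sx xu qs -rev_cons rs sy e_sym yv.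
rewrite -!size_eq0 !size_cat !addnS /= => /(_ isT).
rewrite (_ : perm_eq _ _) => [/(_ isT)//|].
perm_count.
Qed.

(** Otherwise [q] fits between [x] and [y], and one path replaces two. *)
Lemma no_insert P p q x y s1 s2 u t v : minimal P ->
  p \in P -> q \in P -> p != q ->
  spans p (s1 ++ x :: y :: s2) -> spans q (u :: t) -> last u t = v ->
  e x u -> e y v -> False.
Proof.
move=> Pmin pP qP pq.
rewrite -cat_rcons /spans sorted_link => /andP[/and3P[sx xy sy] pE].
move=> /andP[qs qE] lv xu yv.
have [rest E] := perm_two pP qP pq.
have := min_exchange (qs := [:: rcons s1 x ++ u :: t ++ y :: s2]) Pmin E.
rewrite /= sorted_link -cat_cons lastI sorted_link sx xu -lastI qs lv e_sym yv sy /=.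
rewrite -!size_eq0 !size_cat !addnS /= => /(_ isT).
rewrite (_ : perm_eq _ _) => [/(_ isT)//|].
perm_count.
Qed.

Lemma comp_exists P v : path_partition e P -> exists2 p, p \in P & v \in p.
Proof. by case=> _ [_ /(_ v)/flattenP]. Qed.

Definition comp P v := nth [::] P (find (fun p => v \in p) P).

Lemma compP P v : path_partition e P -> (comp P v \in P) * (v \in comp P v).
Proof.
move=> /(comp_exists v)[p pP vp].
have H : has (fun p => v \in p) P by apply/hasP; exists p.
by rewrite mem_nth -?has_find // (nth_find [::] H).
Qed.

Lemma comp_eq P p v : path_partition e P -> p \in P -> v \in p -> comp P v = p.
Proof. by move=> PP pP vp; have [cP vc] := compP v PP; exact: (comp_uniq PP cP pP vc vp). Qed.

(** * Optimal partitions have no single-vertex component *)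

Definition singles P := count (fun p => size p == 1) P.

Definition optimal P :=
  minimal P /\ forall Q, minimal Q -> singles P <= singles Q.

Lemma optimal_exists : exists P, optimal P.
Proof.
have [|k [[P [PP kE]] kmin]] :=
  @ex_least (fun k => exists P, path_partition e P /\ size P = k) (size [seq [:: x] | x <- enum T]).
  exists [seq [:: x] | x <- enum T]; split=> //; split; last split.
  - by move=> p /mapP[x _ ->].
  - by rewrite flatten_seq1 enum_uniq.
  - by move=> v; rewrite flatten_seq1 mem_enum.
have Pmin : minimal P by split=> // Q PQ; rewrite kE; apply: kmin; exists Q.
have [|m [[Q [Qmin mE]] mmin]] :=
  @ex_least (fun k => exists P, minimal P /\ singles P = k) (singles P).
  by exists P.
by exists Q; split=> // R Rmin; rewrite mE; apply: mmin; exists R.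
Qed.

Lemma optimal_exchange P ps qs rest :
  optimal P -> perm_eq P (ps ++ rest) ->
  all (fun q => (q != [::]) && sorted e q) qs ->
  perm_eq (flatten qs) (flatten ps) -> size qs = size ps ->
  singles ps <= singles qs /\ (singles qs = singles ps -> optimal (qs ++ rest)).
Proof.
move=> [[Ppp Pmin] Psing] PE qsP qsE sE.
have Qpp := pp_exchange (pp_perm PE Ppp) qsP qsE.
have Qmin : minimal (qs ++ rest).
  by split=> // R /Pmin; rewrite (perm_size PE) !size_cat sE.
have sPE : singles P = singles ps + singles rest.
  by rewrite -[RHS]count_cat; move/permP: PE; apply.
split=> [|sqE].
  by have := Psing _ Qmin; rewrite sPE [singles (_ ++ _)]count_cat leq_add2r.
split=> //.
suff -> : singles (qs ++ rest) = singles P by [].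
by rewrite sPE [LHS]count_cat -/(singles qs) sqE.
Qed.

Lemma spans_self P p : path_partition e P -> p \in P -> spans p p.
Proof. by move=> [Pp _] /Pp/graph_pathP[_ ps _]; rewrite /spans ps /=. Qed.

Lemma single_nbr P v x : optimal P -> [:: v] \in P -> e v x ->
  exists a c, [:: a; x; c] \in P.
Proof.
move=> Popt vP vx; have [[Pmin _] [Ppp _]] := (Popt, Popt.1).
have [p pP xp] := comp_exists x Ppp.
have vp : [:: v] != p.
  by apply: contraTneq xp => <-; rewrite inE; apply: contraTneq vx => ->; rewrite e_irr.
have ps := spans_self Ppp pP; have vs := spans_self Ppp vP.
have [rest E] := perm_two vP pP vp.
case/splitPr: xp => p1 p2 in pP vp ps E *.
case/lastP: p1 => [|p1 a] in pP vp ps E *.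
  by have := no_merge Pmin vP pP vp vs ps; rewrite vx.
case: p2 => [|c p2] in pP vp ps E *.
  have := spans_rev ps; rewrite rev_cat /= => ps'.
  by have := no_merge Pmin vP pP vp vs ps'; rewrite vx.
have /andP[+ pE] := ps; rewrite sorted_link /= => /and4P[sa ax xc sc].
(* Joining [v] to [x] cuts off one side of the component. That side must be a single vertex, or the
   number of singles would drop; first the side after [x], then the side before it. *)
have [] := optimal_exchange (qs := [:: rcons p1 a ++ [:: x; v]; c :: p2]) Popt E.
- by rewrite /= sorted_link sa ax /= e_sym vx sc -size_eq0 size_cat addnS.
- by perm_count.
- by [].
have [] := optimal_exchange (qs := [:: rcons p1 a; v :: x :: c :: p2]) Popt E.
- by rewrite /= sa vx xc sc -size_eq0 size_rcons.
- by perm_count.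
- by [].
rewrite /singles /= !size_cat !size_rcons /= !addnS !eqSS !addn0 => + _ + _.
case: p1 p2 {ps pE E sa sc vp} pP => [|? ?] [|? ?] //= pP _ _.
by exists a, c.
Qed.

Lemma swap_single P v a x c : optimal P -> [:: v] \in P -> e v x -> [:: a; x; c] \in P ->
  exists Q, [/\ optimal Q, [:: a] \in Q,
    forall r, r \in P -> r != [:: v] -> r != [:: a; x; c] -> r \in Q &
    forall a' x' c', [:: a'; x'; c'] \in Q -> exists a'' c'', [:: a''; x'; c''] \in P].
Proof.
move=> Popt vP vx pP.
have vp : [:: v] != [:: a; x; c] by rewrite eqseq_cons andbF.
have [rest E] := perm_two vP pP vp.
exists ([:: [:: a]; [:: v; x; c]] ++ rest); split.
- have /andP[/= /and3P[_ xc _] _] := spans_self Popt.1.1 pP.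
  have [] := optimal_exchange (qs := [:: [:: a]; [:: v; x; c]]) Popt E.
  + by rewrite /= vx xc.
  + by perm_count.
  + by [].
  by move=> _; apply.
- by rewrite mem_head.
- by move=> r; rewrite (perm_mem E) !inE => /or3P[-> //|-> //|->]; rewrite !orbT.
move=> a' x' c'; rewrite !inE => /or3P[/eqP//|/eqP[_ -> _]|r]; first by exists a, c.
by exists a', c'; rewrite (perm_mem E) mem_cat r orbT.
Qed.

(** Double counting: each vertex of [B] sends [d.+1] edges into its neighbourhood, where each vertex
    gets at most [d.+1]. *)
Lemma regular_expand d (B : {set T}) : regular e d.+1 ->
  #|B| <= #|[set x | [exists v in B, e v x]]|.
Proof.
move=> reg; set N := [set x | _].
rewrite -(leq_pmul2r (ltn0Sn d)) -!sum_nat_const.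
have deg v : d.+1 = \sum_x e v x.
  by rewrite -(reg v) -sum1_card big_mkcond; apply: eq_bigr => x _; rewrite inE; case: (e v x).
under eq_bigr => v _ do rewrite (deg v).
rewrite exchange_big [leqRHS]big_mkcond; apply: leq_sum => x _.
rewrite inE; case: ifPn => [_|/existsPn no].
  rewrite (deg x) big_mkcond; apply: leq_sum => v _; rewrite e_sym.
  by case: ifP.
rewrite big1 // => v vB; apply/eqP; rewrite eqb0.
by have := no v; rewrite vB.
Qed.

(* [good B]: each [v] in [B] is single in an optimal partition obtained by exchanges that move
   no first vertex [a] of a component [a x c] of [P] except those in [B]. *)
Lemma no_single d P u : regular e d.+1 -> optimal P -> [:: u] \notin P.
Proof.
move=> reg Popt; apply/negP => uP; have Ppp := Popt.1.1.
pose good (B : {set T}) := forall v, v \in B -> exists Q, [/\ optimal Q, [:: v] \in Q,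
  forall a x c, [:: a; x; c] \in P -> a \notin B -> [:: a; x; c] \in Q &
  forall a x c, [:: a; x; c] \in Q -> exists a' c', [:: a'; x; c'] \in P].
suff grow m B : #|~: B| < m -> u \in B -> good B -> False.
  apply: (grow _ [set u] (leqnn _)); rewrite ?set11 // => v /set1P->.
  by exists P; split=> // a x c; exists a, c.
elim: m B => [//|m IH] B mB uB gB.
(* Such an [a] joins [B]: its component survives in the partition where [v] is single, so one more
   swap makes [a] single. *)
have [[v [a [x [c [vB vx pP aB]]]]]|full] := classic (exists v a x c,
    [/\ v \in B, e v x, [:: a; x; c] \in P & a \notin B]).
  apply: (IH (a |: B)); rewrite ?setU1r //.
    by rewrite setCU setIC -setDE; have := cardsD1 a (~: B); rewrite inE aB; lia.
  have [Q [Qopt vQ Qkeep Qctr]] := gB v vB.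
  have [R [Ropt aR Rkeep Rctr]] := swap_single Qopt vQ vx (Qkeep _ _ _ pP aB).
  move=> w /setU1P[->|wB].
    exists R; split=> // [b y d' bP|b y d'].
      rewrite !inE negb_or => /andP[ba bB]; apply: Rkeep; first exact: Qkeep.
        by rewrite eqseq_cons andbF.
      by apply: contraNneq ba => -[-> _ _].
    by move=> /Rctr[b' [c' /Qctr]].
  have [S [Sopt wS Skeep Sctr]] := gB w wB; exists S; split=> // b y d' bP.
  by rewrite !inE negb_or => /andP[_ bB]; apply: Skeep.
have := regular_expand B reg; set N := [set x | _] => BN.
have leaf x : x \in N -> exists a c, [:: a; x; c] \in P /\ a \in B.
  rewrite inE => /existsP[v /andP[vB vx]].
  have [Q [Qopt vQ _ Qctr]] := gB v vB.
  have [a' [c' /Qctr[a [c pP]]]] := single_nbr Qopt vQ vx.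
  exists a, c; split=> //; apply: contraT => aB.
  by case: full; exists v, a, x, c.
(* Mapping a centre to the first vertex of its component is injective from [N] into [B], and misses
   [u], which is single in [P]. So [N] is smaller than [B]. *)
pose f x := head x (comp P x).
have fP x : x \in N -> exists c, [:: f x; x; c] \in P /\ f x \in B.
  move=> /leaf[a [c [pP aB]]]; exists c.
  by rewrite /f (@comp_eq _ [:: a; x; c]) // !inE eqxx orbT.
have finj : {in N &, injective f}.
  move=> x y /fP[c [xP _]] /fP[d' [yP _]] fE.
  have := @comp_uniq P _ _ (f x) Ppp xP yP.
  by rewrite fE !mem_head => /(_ isT isT)[].
have fB : f @: N \subset B :\ u.
  apply/subsetP => _ /imsetP[x /fP[c [pP fxB]] ->].
  rewrite !inE fxB andbT; apply: contraTneq uP => <-; apply/negP => fP'.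
  have := @comp_uniq P _ _ (f x) Ppp pP fP'.
  by rewrite !mem_head => /(_ isT isT).
have := subset_leq_card fB; rewrite card_in_imset //.
by move: BN; rewrite (cardsD1 u B) uB; clear; lia.
Qed.

(** * Components spanned by a cycle, and ends *)

(** A single edge counts as a cycle, since [cycle] runs through it in both directions. *)
Definition cyc p := [exists t : (size p).-tuple T, perm_eq t p && cycle e t].

Lemma cycP p : reflect (exists s, perm_eq s p && cycle e s) (cyc p).
Proof.
apply: (iffP existsP) => [[t tP]|[s sP]]; first by exists t.
have /andP[sE _] := sP.
have ss : size s == size p by rewrite (perm_size sE).
by exists (Tuple ss).
Qed.

Lemma cyc_spans p v : cyc p -> v \in p ->
  exists2 t, spans p (v :: t) & e (last v t) v.
Proof.
move=> /cycP[t /andP[tE tc]]; rewrite -(perm_mem tE) => vt.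
case: (rot_to vt) => i t' rE; exists t'.
  move: tc; rewrite /spans -(rot_cycle i) -rE perm_rot tE rE /= rcons_path andbT.
  by case/andP.
by move: tc; rewrite -(rot_cycle i) rE /= rcons_path => /andP[].
Qed.

Definition is_end p u := (u \in p) && [|| cyc p, u == head u p | u == last u p].

Lemma end_spans P p u : path_partition e P -> p \in P -> is_end p u ->
  exists s, spans p (u :: s).
Proof.
move=> PP pP /andP[up]; have ps := spans_self PP pP.
case/or3P => [cp|/eqP uE|/eqP uE].
- by have [t] := cyc_spans cp up; exists t.
- by case: p {pP} up uE ps => [//|a p] _ /= <- ps; exists p.
- case/lastP: p {pP} up uE ps => [//|p b] _; rewrite last_rcons => <- /spans_rev.
  by rewrite rev_rcons; exists (rev p).
Qed.

(* Two vertices of a cycle on at least 4 vertices need not be the ends of a spanning path, so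
   [end_spans2] fails there; the lower rate compensates for this. *)
Definition rate p := if cyc p && (3 < size p) then 1 else 2.

Lemma rate_le2 p : rate p <= 2.
Proof. by rewrite /rate; case: ifP. Qed.

(** Rate 2 leaves an edge or a triangle, where any two vertices end a spanning path, or a component
    without spanning cycle, whose only ends are its first and last vertex. *)
Lemma end_spans2 P p u v : path_partition e P -> p \in P -> rate p = 2 ->
  is_end p u -> is_end p v -> u != v ->
  exists s, spans p (u :: s) /\ last u s = v.
Proof.
move=> PP pP; rewrite /rate /is_end; have ps := spans_self PP pP.
case: (boolP (cyc p)) => [cp|_] /=.
  case: ltnP => // p3 _ /andP[up _] /andP[vp _] uv.
  have [s sp su] := cyc_spans cp up; have /andP[ss sE] := sp.
  move: vp p3; rewrite -(perm_mem sE) -(perm_size sE) inE eq_sym (negPf uv) /=.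
  case: s sp su ss sE => [//|y [|z [|? ?]]] //= sp zu.
    by move=> _ _; rewrite inE => /eqP-> _; exists [:: y].
  move=> /and3P[uy yz _] sE; rewrite !inE => /orP[]/eqP-> _; last by exists [:: y; z].
  exists [:: z; y]; split=> //; rewrite /spans /= e_sym zu e_sym yz /=.
  by apply: perm_trans sE; rewrite perm_cons; apply/permP => a /=; clear; lia.
move=> _ /andP[up uE] /andP[vp vE] uv.
move: uE vE => /orP[]uE /orP[]vE.
- case: p {vp pP} up ps uE vE => [//|a p] /= _ _ /eqP uE /eqP vE.
  by rewrite uE vE eqxx in uv.
- case: p {vp pP} up ps uE vE => [//|a p] /= _ ps /eqP uE /eqP vE; exists p; subst a.
  by rewrite -vE.
- case: p {up pP} vp ps uE vE => [//|a p] /= _ ps /eqP uE /eqP vE; subst a.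
  have := spans_rev ps; rewrite lastI rev_rcons -uE => rs.
  exists (rev (belast v p)); split=> //.
  case: p uE {ps rs} => [|z p] /= uE; first by rewrite uE eqxx in uv.
  by rewrite rev_cons last_rcons.
- case: p {vp pP} up ps uE vE => [//|a p] /= _ _ /eqP uE /eqP vE.
  by rewrite uE vE eqxx in uv.
Qed.

(** * Rotations *)

(** The edge from the first vertex to [z] replaces [y z]. For empty [s1] the first vertex is [y],
    hence the default of [head]. *)
Lemma rot_head p s1 y z s2 : spans p (s1 ++ y :: z :: s2) -> e (head y s1) z ->
  spans p (y :: rev s1 ++ z :: s2).
Proof.
case: s1 => [|a s1] //= /andP[+ pE] az.
rewrite -cat_cons -cat_rcons sorted_link => /and3P[s1s _ s2s].
rewrite /spans rev_cons -cat_cons -rcons_cons sorted_link az s2s andbT /=.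
rewrite -[path _ _ _]/(sorted e (y :: rcons (rev s1) a)) -rev_cons -rev_rcons.
rewrite rev_sorted_sym s1s /=.
perm_count.
Qed.

Lemma rot_last p s1 y z s2 : spans p (s1 ++ y :: z :: s2) -> e (last z s2) y ->
  spans p (z :: s2 ++ y :: rev s1).
Proof.
move=> /spans_rev; rewrite rev_cat !rev_cons !cat_rcons => ps zy.
by rewrite -[s2]revK; apply: rot_head ps _; case/lastP: s2 zy => [|s2 b]; rewrite ?last_rcons ?rev_rcons.
Qed.

(** The rotated path starts at [y], so the edge from the last vertex to [y] closes it. *)
Lemma crossing_cyc p s1 y z s2 : spans p (s1 ++ y :: z :: s2) ->
  e (head y s1) z -> e (last z s2) y -> cyc p.
Proof.
move=> ps yz zy; have /andP[ss pE] := rot_head ps yz.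
apply/cycP; exists (y :: rev s1 ++ z :: s2); rewrite pE /= rcons_path last_cat /= zy andbT.
exact: ss.
Qed.

(** * Fees *)

Definition pays P u x := [&& e u x, comp P u != comp P x & is_end (comp P u) u].
Definition fee P u x := pays P u x * rate (comp P u).
Definition receives P x := [exists u, pays P u x].
(** The names follow the edge from the end [u] to [x], but the units flow backwards: [income] is
    what [x] must pay, [outgo] is what the component of [u] gains. *)
Definition income P x := \sum_u fee P u x.
Definition outgo P u := \sum_x fee P u x.

Lemma end_not_receives P p x s : minimal P -> p \in P -> spans p (x :: s) ->
  receives P x = false.
Proof.
move=> Pmin pP ps; apply: negbTE; apply/existsP => -[u /and3P[ux uNx uend]].
have PP := Pmin.1; have [uP _] := compP u PP.
have xp : x \in p by have /andP[_ /perm_mem<-] := ps; rewrite mem_head.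
rewrite (comp_eq PP pP xp) in uNx.
have [t ut] := end_spans PP uP uend.
by have := no_merge Pmin uP pP uNx ut ps; rewrite ux.
Qed.

Lemma income0 P x : receives P x = false -> income P x = 0.
Proof.
move=> /negbT/existsPn no; apply: big1 => u _.
by rewrite /fee (negPf (no u)).
Qed.

(** Different components contradict [no_split]; different ends at rate 2 contradict [no_insert]. *)
Lemma payers_eq P p s1 x y s2 u v : minimal P -> p \in P ->
  spans p (s1 ++ x :: y :: s2) -> pays P u x -> pays P v y ->
  comp P u = comp P v /\ (rate (comp P u) = 2 -> u = v).
Proof.
move=> Pmin pP ps /and3P[ux uNx uend] /and3P[vy vNy vend].
have PP := Pmin.1; have [uP _] := compP u PP; have [vP _] := compP v PP.
have memp : {subset [:: x; y] <= p}.
  move=> z; have /andP[_ /perm_mem<-] := ps; rewrite mem_cat !inE.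
  by case/orP=> ->; rewrite !orbT.
rewrite (comp_eq PP pP (memp x _)) ?inE ?eqxx // eq_sym in uNx.
rewrite (comp_eq PP pP (memp y _)) ?inE ?eqxx ?orbT // eq_sym in vNy.
rewrite e_sym in ux; rewrite e_sym in vy.
have [uvE|uv] := eqVneq (comp P u) (comp P v); last first.
  have [s us] := end_spans PP uP uend; have [t vt] := end_spans PP vP vend.
  by case: (no_split Pmin pP uP vP uNx vNy uv ps us vt ux vy).
split=> // r2; apply/eqP; apply: contraT => uv.
rewrite -uvE in vend.
have [s [us ls]] := end_spans2 PP uP r2 uend vend uv.
by case: (no_insert Pmin pP uP uNx ps us ls ux vy).
Qed.

Lemma income_le P x : income P x <= 2 * #|[set u | pays P u x]|.
Proof.
rewrite -sum1_card big_distrr /= [leqRHS]big_mkcond; apply: leq_sum => u _.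
by rewrite inE /fee; case: ifP => _ //; rewrite mul1n rate_le2.
Qed.

(** All ends charging [x] lie in one component. At rate 2 there is at most one of them; otherwise
    each fee is 1. *)
Lemma income_adjacent P p s1 x y s2 : minimal P -> p \in P ->
  spans p (s1 ++ x :: y :: s2) -> receives P y ->
  income P x <= 2 \/ income P x <= #|[set u | pays P u x]|.
Proof.
move=> Pmin pP ps /existsP[v vy].
have key u : pays P u x -> comp P u = comp P v /\ (rate (comp P v) = 2 -> u = v).
  by move=> ux; have [E] := payers_eq Pmin pP ps ux vy; rewrite E.
have [r2|r1] := eqVneq (rate (comp P v)) 2; [left|right].
  rewrite /income (bigD1 v) //= big1 ?addn0 => [|u uv].
    by rewrite /fee r2; case: (pays _ _ _).
  rewrite /fee; case: (boolP (pays P u x)) => // /key[_ /(_ r2) uE].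
  by rewrite uE eqxx in uv.
rewrite -sum1_card [leqRHS]big_mkcond; apply: leq_sum => u _.
rewrite inE /fee; case: (boolP (pays P u x)) => // /key[-> _]; rewrite mul1n.
by move: r1; rewrite /rate; case: ifP.
Qed.

(** * Degree counts and the balance of each component *)

Lemma card_in_seq p (a : pred T) : uniq p -> #|[set x in p | a x]| = count a p.
Proof.
move=> pu; rewrite -size_filter -(card_uniqP (filter_uniq a pu)).
by apply: eq_card => x; rewrite inE mem_filter andbC.
Qed.

Lemma comp_in P p x : path_partition e P -> p \in P -> (p != comp P x) = (x \notin p).
Proof.
move=> PP pP; congr (~~ _); apply/eqP/idP => [->|xp]; first by case: (compP x PP).
by rewrite (comp_eq PP pP xp).
Qed.

Lemma member_uniq P p : path_partition e P -> p \in P -> uniq p.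
Proof. by case=> Pp _ /Pp/graph_pathP[]. Qed.

Lemma outgo_end d P p u : regular e d -> path_partition e P -> p \in P -> is_end p u ->
  outgo P u + rate p * count (e u) p = rate p * d.
Proof.
move=> reg PP pP uend; have up : u \in p by case/andP: uend.
have uE := comp_eq PP pP up.
have -> : outgo P u = rate p * #|nbhd e u :\: [set x in p]|.
  rewrite -sum1_card big_distrr /= [RHS]big_mkcond; apply: eq_bigr => x _.
  rewrite /fee /pays uE uend (comp_in _ PP pP) !inE andbT andbC.
  by case: (_ && _); rewrite ?mul1n ?muln1.
rewrite -mulnDr -(card_in_seq _ (member_uniq PP pP)); congr (_ * _).
rewrite -(reg u) -(cardsID [set x in p] (nbhd e u)) addnC; congr (_ + _).
by apply: eq_card => x; rewrite !inE andbC.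
Qed.

Lemma payers_degree d P p x : regular e d -> path_partition e P -> p \in P -> x \in p ->
  #|[set u | pays P u x]| + count (e x) p <= d.
Proof.
move=> reg PP pP xp.
rewrite -(card_in_seq _ (member_uniq PP pP)) -(reg x).
rewrite -(cardsID [set y in p] (nbhd e x)) addnC leq_add //; apply: subset_leq_card.
  by apply/subsetP => y; rewrite !inE andbC.
apply/subsetP => y; rewrite !inE /pays (comp_eq PP pP xp) eq_sym (comp_in _ PP pP) e_sym.
by case/and3P => -> ->.
Qed.

Lemma count_inner p u : u \in p -> count (e u) p < size p.
Proof.
move=> up; rewrite -(count_predC (e u) p) -[X in X < _]addn0 ltn_add2l -has_count.
by apply/hasP; exists u; rewrite //= e_irr.
Qed.

Lemma balance_cyc P p : regular e 5 -> ~ has_clique e 6 -> optimal P -> p \in P -> cyc p ->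
  19 + \sum_(x <- p) income P x <= 3 * size p + \sum_(u <- p) outgo P u.
Proof.
move=> reg noK6 Popt pP cp; have Pmin := Popt.1; have PP := Pmin.1.
have pu := member_uniq PP pP.
rewrite big_seq big1 => [|x xp]; last first.
  by have [t xt _] := cyc_spans cp xp; apply: income0; apply: end_not_receives Pmin pP xt.
have out u : u \in p -> outgo P u + rate p * count (e u) p = rate p * 5.
  by move=> up; apply: outgo_end; rewrite // /is_end up cp.
(* At least [6 - size p] edges leave [p] at each vertex. Sizes 2, 3, 4, 5 thus reach 22, 27, 20, 20
   units. *)
have lower : size p * (rate p * (6 - size p)) <= \sum_(u <- p) outgo P u.
  rewrite mulnC -iter_addn_0 -[X in iter X]count_predT -big_const_seq !big_seq.
  apply: leq_sum => u up; have := out u up; have := count_inner up.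
  have : rate p = 1 \/ rate p = 2 by rewrite /rate; case: ifP; [left|right].
  by move: (outgo P u) (count _ _) (size p) (rate p); clear; nia.
have p0 : p != [::] by have [Pp _] := PP; case/graph_pathP: (Pp _ pP).
have p1 : size p != 1.
  by case: (p) pP => [|u [|? ?]] // uP; have := no_single u reg Popt; rewrite uP.
have [p7|p6] := leqP 7 (size p); first by move: p7; clear; lia.
have [p6E|p6N] := eqVneq (size p) 6; last first.
  move: lower; rewrite /rate cp /=; move: p0 p1 p6 p6N; rewrite -size_eq0.
  move: (\sum_(_ <- _) _) => S; clear.
  by case: (size p) => [|[|[|[|[|[|[|?]]]]]]] //=; lia.
(* Six vertices own 18 units. Any leaving edge brings the missing one, and without such an edge [p]
   is a [K_6]. *)
suff [u up uo] : exists2 u, u \in p & 0 < outgo P u.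
  rewrite p6E (big_rem u) //=; move: uo; clear.
  by move: (outgo P u) (\sum_(_ <- _) _); lia.
apply: NNPP => noout; apply: noK6; exists [set x in p].
split; first by rewrite cardsE (card_uniqP pu).
move=> x y; rewrite !inE => xp yp xy; apply: contraT => nxy.
case: noout; exists x => //.
have := out x xp; have : count (e x) p + 2 <= 6.
  rewrite -p6E -(count_predC (e x) p) leq_add2l.
  rewrite -(card_in_seq _ pu).
  have /subset_leq_card : [set x; y] \subset [set z in p | predC (e x) z].
    by apply/subsetP => z; rewrite !inE => /orP[]/eqP->; rewrite ?xp ?yp ?e_irr.
  by rewrite cards2 xy.
rewrite /rate cp p6E /=; clear; lia.
Qed.
Lemma balance_path P p : regular e 5 -> optimal P -> p \in P -> ~~ cyc p ->
  19 + \sum_(x <- p) income P x <= 3 * size p + \sum_(u <- p) outgo P u.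
Proof.
move=> reg Popt pP ncp; have Pmin := Popt.1; have PP := Pmin.1.
have pu := member_uniq PP pP; have ps := spans_self PP pP.
have rp : rate p = 2 by rewrite /rate (negPf ncp).
have [a [p' pE]] : exists a p', p = a :: p'.
  by have [Pp _] := PP; have [+ _ _] := (graph_pathP p).1 (Pp p pP); case: (p) => [|a p'] // _; exists a, p'.
pose n := size p'; have sp : size p = n.+1 by rewrite pE.
have n0 : 0 < n.
  rewrite /n; case: p' pE {n sp} => [|//] pE; have := no_single a reg Popt.
  by rewrite -pE pP.
pose b := last a p'; pose q i := nth a p i.
have q0 : q 0 = a by rewrite /q pE.
have qn : q n = b by rewrite /q /b pE (last_nth a).
have split_at i : i < n -> exists s1 s2,
    [/\ spans p (s1 ++ q i :: q i.+1 :: s2), head (q i) s1 = a & last (q i.+1) s2 = b].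
  move=> lin; exists (take i p), (drop i.+2 p).
  have E : p = take i p ++ q i :: q i.+1 :: drop i.+2 p.
    by rewrite -!drop_nth ?cat_take_drop // sp ltnS // ltnW.
  split; first by rewrite -E.
    by rewrite /q pE; case: (i).
  have : last a p = b by rewrite pE.
  by rewrite {1}E last_cat /= => ->.
pose R i := receives P (q i).
(* The guards exclude the path edges at [a] and [b]. *)
pose A i := (0 < i) && e a (q i.+1); pose B i := (i.+1 < n) && e b (q i).
have AR i : i < n -> ~~ (A i && R i).
  move=> /split_at[s1 [s2 [si ha lb]]]; apply/negP => /andP[/andP[_ az]].
  rewrite /R (end_not_receives (s := rev s1 ++ q i.+1 :: s2) Pmin pP) //.
  by apply: rot_head => //; rewrite ha.
have BR i : i < n -> ~~ (B i && R i.+1).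
  move=> /split_at[s1 [s2 [si ha lb]]]; apply/negP => /andP[/andP[_ bz]].
  rewrite /R (end_not_receives (s := s2 ++ q i :: rev s1) Pmin pP) //.
  by apply: rot_last => //; rewrite lb.
have AB i : i < n -> ~~ (A i && B i).
  move=> /split_at[s1 [s2 [si ha lb]]]; apply: contra ncp => /andP[/andP[_ az] /andP[_ bz]].
  by apply: (crossing_cyc si); rewrite ?ha ?lb.
have R0 : R 0 = false.
  by apply: (end_not_receives (s := p') Pmin pP); rewrite /q pE -pE.
have Rn : R n = false.
  rewrite /R qn; apply: (end_not_receives (s := rev (belast a p')) Pmin pP).
  by rewrite -rev_rcons -lastI -pE; apply: spans_rev.
have f0 i : ~~ R i -> income P (q i) = 0 by move/negbTE/income0.
have qe i : i < n -> e (q i) (q i.+1).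
  by move=> lin; have /andP[/(sortedP a) + _] := ps; apply; rewrite sp ltnS.
have cost i : i.+1 < n -> R i.+1 ->
    income P (q i.+1) + 2 * A i + 2 * B i.+1 <= (if R i then 2 else 3) + (if R i.+2 then 1 else 3).
  move=> lin Ri; have lin' := ltnW lin.
  have qp : q i.+1 \in p by rewrite mem_nth // sp ltnS.
  (* The neighbours counted are [q_i], [q_(i+2)], and [a] or [b] if adjacent; the guards keep them
     distinct. At most [3 - A i - B i.+1] edges remain for fees. *)
  have inner : 2 + A i + B i.+1 <= count (e (q i.+1)) p.
    pose idx := [:: i; i.+2] ++ nseq (A i) 0 ++ nseq (B i.+1) n.
    have <- : size (map q idx) = 2 + A i + B i.+1.
      by rewrite size_map !size_cat !size_nseq addnA.
    rewrite -size_filter; apply: uniq_leq_size.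
      rewrite map_inj_in_uniq => [|j k jx kx /eqP].
        rewrite /idx /A /B; move: (e _ _) (e _ _) lin; clear => u v lin.
        by case: posnP => i0; case: ltnP => iN; case: u; case: v; rewrite //= ?inE /=; lia.
      have small l : l \in idx -> l < size p.
        rewrite sp ltnS !mem_cat !inE !mem_nseq => /or3P[/orP[]/eqP->|/andP[_ /eqP->]|/andP[_ /eqP->]] //.
        exact: ltnW.
      by rewrite nth_uniq ?small // => /eqP.
    move=> _ /mapP[l lx ->]; rewrite mem_filter.
    move: lx; rewrite !mem_cat !inE !mem_nseq => /or3P[/orP[]/eqP->|/andP[+ /eqP->]|/andP[+ /eqP->]].
    - by rewrite e_sym qe //= mem_nth // sp ltnS; apply: ltnW.
    - by rewrite qe //= mem_nth // sp ltnS.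
    - by rewrite lt0b => /andP[_]; rewrite q0 e_sym => ->; rewrite pE mem_head.
    - by rewrite lt0b => /andP[_]; rewrite qn e_sym => ->; rewrite pE mem_last.
  have := payers_degree reg PP pP qp; have := income_le P (q i.+1).
  have right_nbr : R i.+2 -> income P (q i.+1) <= 2 \/
      income P (q i.+1) <= #|[set u | pays P u (q i.+1)]|.
    by have [s1 [s2 [si _ _]]] := split_at _ lin; apply: income_adjacent Pmin pP si.
  have left_nbr : R i -> income P (q i.+1) <= 2 \/
      income P (q i.+1) <= #|[set u | pays P u (q i.+1)]|.
    have [s1 [s2 [/spans_rev si _ _]]] := split_at _ lin'.
    move: si; rewrite rev_cat !rev_cons !cat_rcons => si.
    exact: income_adjacent Pmin pP si.
  have := BR _ lin; have := AR _ lin'; move: right_nbr left_nbr inner.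
  move: (income _ _) (count _ _) #|_| => I c m; clear.
  case: (R i.+2) => [/(_ isT) r|_]; case: (R i) => [/(_ isT)|_];
    by case: (A i); case: (B i.+1); rewrite //=; lia.
have := budget AR BR AB f0 R0 Rn cost.
have inner c : count (e c) p = \sum_(0 <= i < n.+1) e c (q i).
  by rewrite -sum1_count big_mkcond (big_nth a) sp; apply: eq_bigr => i _; case: (e _ _).
have inner_a : count (e a) p <= 1 + \sum_(0 <= i < n) A i.
  rewrite inner big_nat_recl // q0 e_irr add0n /A; case: (n) n0 => // m _.
  by rewrite !big_nat_recl //= add0n leq_add2r leq_b1.
have inner_b : count (e b) p <= 1 + \sum_(0 <= i < n) B i.
  rewrite inner big_nat_recr //= qn e_irr addn0 /B; case: (n) n0 => // m _.
  rewrite !big_nat_recr //= ltnn addn0 addnC leq_add ?leq_b1 //.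
  by rewrite leq_eqVlt; apply/orP; left; apply/eqP/eq_big_nat => i /andP[_ im]; rewrite ltnS im.
have out u : is_end p u -> outgo P u + 2 * count (e u) p = 10.
  by move=> uend; have := outgo_end reg PP pP uend; rewrite rp.
have aend : is_end p a by rewrite /is_end pE mem_head /= eqxx !orbT.
have bend : is_end p b by rewrite /is_end pE mem_last /= eqxx !orbT.
have bp' : b \in p'.
  by move: n0; rewrite /b /n; case: (p') => //= c s _; rewrite mem_last.
(* Here [19 = 3 + 8 + 8]: there is one vertex more than path edges, and each of [a], [b] gains 8
   less 2 per inner non-path edge, which the budget covers. *)
have := out a aend; have := out b bend; move: inner_a inner_b.
rewrite sp (big_nth a) sp [X in _ -> _ -> _ -> _ -> _ -> _ <= _ + X](_ : _ =
  outgo P a + (outgo P b + \sum_(u <- rem b p') outgo P u)); last first.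
  by rewrite {1}pE big_cons (big_rem b).
rewrite -/q; move: (outgo P a) (outgo P b) (count (e a) p) (count (e b) p).
move: (\sum_(u <- rem b p') _) (\sum_(0 <= i < n) A i) (\sum_(0 <= i < n) B i).
by move: (\sum_(0 <= i < n.+1) _); clear; lia.
Qed.

(** * Summation over all components *)

Lemma sum_comp P (F : T -> nat) : path_partition e P ->
  \sum_(p <- P) \sum_(x <- p) F x = \sum_x F x.
Proof.
move=> [_ [Pu Pc]]; rewrite -big_flatten; apply: perm_big.
apply: uniq_perm => //; first exact: index_enum_uniq.
by move=> x; rewrite Pc mem_index_enum.
Qed.

End PathPartition.

Theorem theorem2 (T : finType) (e : rel T) :
  simple_graph e -> regular e 5 -> ~ has_clique e 6 ->
  exists P : seq (seq T), path_partition e P /\ 19 * size P <= 3 * #|T|.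
Proof.
move=> [e_sym e_irr] reg noK6; have [P Popt] := optimal_exists e.
have PP := Popt.1.1; exists P; split=> //.
(* Each fee is gained once and paid once, so fees cancel in the total. *)
have flow : \sum_u outgo e P u = \sum_x income e P x by apply: exchange_big.
rewrite -(leq_add2r (\sum_x income e P x)) -{2}flow -sum1_card.
rewrite -!(sum_comp _ PP) -sum1_size !big_distrr -!big_split /= !big_seq.
apply: leq_sum => p pP; rewrite sum1_size muln1.
have [cp|ncp] := boolP (cyc e p); first exact: balance_cyc.
exact: balance_path.
Qed.
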